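(* Suppose there exist norms $\|\cdot\|_{V^h}$ on $V^h$ and $\|\cdot\|_{M^h}$ on $M^h$ such that (1) $\|v\|_a\le \|v\|_{V^h}$ for all $v\in V^h$; (2) there is a real number $\|\overline a\|$ with $|\overline a(v,\mu^h)|\le \|\overline a\|\,\|v\|_{V^h}\,\|\mu^h\|_{M^h}$ for all $v\in V^h$ and $\mu^h\in M^h$; (3) there is $\alpha>0$ with $$\inf_{\mu^h\in M^h\setminus\{0\}}\ \sup_{v^h\in P^h_D\setminus\{0\}}\frac{\overline a(v^h,\mu^h)}{\|v^h\|_a\,\|\mu^h\|_{M^h}}\ \ge\ \alpha .$$ Let $p$ be the solution of the continuous problem, i.e. $p\in H^1_D(\Omega)$ with $a(p,v)=F(v)$ for all $v\in H^1_D(\Omega)$. Then $p\in H^1_{div,\Lambda}(\Omega)$, $\overline a(p,\mu)=\overline F(\mu)$ for all $\mu\in M^h$, and $(p,0)$ solves the continuous saddle point problem $a(p,v)+\overline a(v,\lambda)=F(v)$ for all $v\in H^1_{div,\Lambda}(\Omega)$, $\overline a(p,\mu)=\overline F(\mu)$ for all $\mu\in M^h$, with $\lambda=0$. Let $(p^h,\lambda^h)\in P^h_D\times M^h$ be the solution of the discrete saddle point problem $$a(p^h,v^h)+\overline a(v^h,\lambda^h)=F(v^h)\quad\forall v^h\in P^h_D,\qquad \overline a(p^h,\mu^h)=\overline F(\mu^h)\quad\forall \mu^h\in M^h .$$ Then $$\|p-p^h\|_a\ \le\ 2\left(1+\frac{\|\overline a\|}{\alpha}\right)\inf_{v^h\in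 P^h_D}\|p-v^h\|_{V^h}.$$
   Context: $\Omega\subset\mathbb R^2$ is a convex polygonal domain, and $\partial\Omega_D\subset\partial\Omega$ is the Dirichlet part of its boundary. $H^1_D(\Omega)$ is the subspace of $H^1(\Omega)$ of functions vanishing on $\partial\Omega_D$; if $|\partial\Omega_D|=0$ it is instead the subspace of functions of $H^1(\Omega)$ with zero average. $q\in L^2(\Omega)$, with $\int_\Omega q\,dx=0$ if $|\partial\Omega_D|=0$. $\Lambda$ is a $2\times2$ matrix field with entries in $L^\infty(\Omega)$, almost everywhere symmetric positive definite, with eigenvalues bounded below uniformly by a positive constant. Forms: $a(u,v)=\int_\Omega \Lambda\nabla u\cdot\nabla v\,dx$, $F(v)=\int_\Omega qv\,dx$, and $\|v\|_a^2=a(v,v)$ for $v\in H^1_D(\Omega)$. $H^1_{div,\Lambda}(\Omega)=\{v\in H^1_D(\Omega):\Lambda\nabla v\in H(\mathrm{div},\Omega)\}$. Meshes and discrete spaces: $\mathcal T_h$ is a (primal) triangulation of $\Omega$ into triangles or squares $R_\ell$, $1\le \ell\le N_h$. $\mathcal T_h^*=\{V_k\}_{k=1}^{N_h^*}$ is a dual mesh whose elements $V_k\subset\Omega$ are called control volumes, one for each vertex of $\mathcal T_h$ for which the associated control volume satisfies $|V_k\cap\partial\Omega_D|=0$ (all vertices if $|\partial\Omega_D|=0$). $P^h$ is the space of continuous functions that are piecewise polynomials of degree $r$ on the elements of $\mathcal T_h$ ($\mathbb Q^r$ elements), and $P^h_D=P^h\cap H^1_D(\Omega)$. $M^h$ is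 the space of piecewise constant functions on $\mathcal T_h^*$; $\mu\in M^h$ is identified with the vector $(\mu_k)_{k=1}^{N_h^*}$, $\mu_k=\mu|_{V_k}$. $V^h=\mathrm{Span}\{P^h_D,\,H^1_{div,\Lambda}(\Omega)\}$. Total flux forms: $\overline a(v,\mu)=\sum_{k=1}^{N_h^*}\mu_k\int_{\partial V_k}-\Lambda\nabla v\cdot\mathbf n$, with $\mathbf n$ the outward unit normal of $V_k$, and $\overline F(\mu)=\sum_{k=1}^{N_h^*}\mu_k\int_{V_k}q\,dx$. For $v\in H^1_{div,\Lambda}(\Omega)$ the boundary integral is understood through integration by parts against the constant function $1$, i.e. $\int_{\partial V_k}-\Lambda\nabla v\cdot\mathbf n=-\int_{V_k}\mathrm{div}(\Lambda\nabla v)\,dx$; for $v\in P^h_D$ it is computed along $\partial V_k$, piecewise on the primal elements. It is presupposed that $\overline a$ is thereby a well-defined bilinear form on $V^h\times M^h$. *)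

(* Defs.v *)
From HB Require Import structures.
From mathcomp Require Import all_boot all_order all_algebra.
From mathcomp Require Import all_classical all_reals all_analysis.

Set Implicit Arguments.
Unset Strict Implicit.
Unset Printing Implicit Defensive.

Import Order.TTheory GRing.Theory Num.Theory.
Import numFieldNormedType.Exports.

Local Open Scope classical_set_scope.
Local Open Scope ring_scope.

Notation leb1 := (@lebesgue_measure _).
Notation leb2 := (@lebesgue_measure _ \x @lebesgue_measure _)%E.

(* The library norm on R * R is the sup norm; [elen] is the Euclidean one. *)
Definition dot (R : realType) (u w : R * R) : R := u.1 * w.1 + u.2 * w.2.
Definition elen (R : realType) (u : R * R) : R := Num.sqrt (dot u u).
Definition rot90 (R : realType) (u : R * R) : R * R := (- u.2, u.1).
Definition mulv (R : realType) (A : 'M[R]_2) (u : R * R) : R * R :=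
  (A 0 0 * u.1 + A 0 1 * u.2, A 1 0 * u.1 + A 1 1 * u.2).

Definition gradf (R : realType) (f : R * R -> R) (x : R * R) : R * R :=
  ('D_((1, 0) : R * R) f x, 'D_((0, 1) : R * R) f x).

(* Class C^n on the whole plane, by continuity of the iterated partials. *)
Fixpoint Cn (R : realType) (n : nat) (f : R * R -> R) : Prop :=
  if n is m.+1 then
    forall e : R * R, e = (1, 0) \/ e = (0, 1) ->
      (forall x, derivable f x e) /\ Cn m (fun x => 'D_e f x)
  else continuous f.

Definition smooth (R : realType) (f : R * R -> R) : Prop := forall n, Cn n f.

Definition test_fun (R : realType) (Omega : set (R * R)) (phi : R * R -> R) :=
  smooth phi /\
  exists K : set (R * R),
    [/\ compact K, K `<=` Omega & forall x, ~ K x -> phi x = 0].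

Definition L2 (R : realType) (Omega : set (R * R)) (f : R * R -> R) : Prop :=
  f \_ Omega \in Lfun leb2 2%:E.
Definition L2norm (R : realType) (Omega : set (R * R)) (f : R * R -> R)
    : \bar R :=
  ('N[leb2]_2 [EFin \o (f \_ Omega)])%E.
Definition Linf (R : realType) (Omega : set (R * R)) (f : R * R -> R) : Prop :=
  f \_ Omega \in Lfun leb2 +oo%E.

(* A Sobolev function is carried together with its weak gradient: [v.1] is the
   function and [v.2] its gradient (unique up to a null set). Values outside
   the domain are irrelevant, and two such pairs represent the same element of
   H^1 when their first components agree almost everywhere; the pairs form an
   lmodType under the pointwise operations. *)
Definition jet (R : realType) := ((R * R -> R) * (R * R -> R * R))%type.

Definition ae_zero (R : realType) (Omega : set (R * R)) (v : jet R) : Prop :=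
  {ae leb2, forall x, Omega x -> v.1 x = 0}.

Definition H1 (R : realType) (Omega : set (R * R)) (v : jet R) : Prop :=
  [/\ L2 Omega v.1,
      L2 Omega (fun x => (v.2 x).1),
      L2 Omega (fun x => (v.2 x).2) &
      forall phi, test_fun Omega phi ->
        (\int[leb2]_(x in Omega) (v.1 x * (gradf phi x).1)
          = - \int[leb2]_(x in Omega) ((v.2 x).1 * phi x)) /\
        (\int[leb2]_(x in Omega) (v.1 x * (gradf phi x).2)
          = - \int[leb2]_(x in Omega) ((v.2 x).2 * phi x))].

(* [d] is the divergence of [sigma] in the sense of H(div, Omega). *)
Definition weak_div (R : realType) (Omega : set (R * R))
    (sigma : R * R -> R * R) (d : R * R -> R) : Prop :=
  L2 Omega d /\
  forall phi, test_fun Omega phi ->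
    \int[leb2]_(x in Omega) dot (sigma x) (gradf phi x)
      = - \int[leb2]_(x in Omega) (d x * phi x).

Definition in_Hdiv (R : realType) (Omega : set (R * R))
    (sigma : R * R -> R * R) : Prop :=
  [/\ L2 Omega (fun x => (sigma x).1), L2 Omega (fun x => (sigma x).2) &
      exists d, weak_div Omega sigma d].

Definition vert (R : realType) (w : seq (R * R)) (i : nat) : R * R :=
  nth 0 w (i %% size w).
Definition edge_vec (R : realType) (w : seq (R * R)) (i : nat) : R * R :=
  vert w i.+1 - vert w i.
Definition edge_pt (R : realType) (w : seq (R * R)) (i : nat) (t : R) : R * R :=
  vert w i + t *: edge_vec w i.
Definition edge (R : realType) (w : seq (R * R)) (i : nat) : set (R * R) :=
  [set x | exists2 t, 0 <= t <= 1 & x = edge_pt w i t].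
Definition normal (R : realType) (w : seq (R * R)) (i : nat) : R * R :=
  (elen (edge_vec w i))^-1 *: - rot90 (edge_vec w i).

(* [K] is the closed region bounded by the simple closed polygonal curve [w],
   listed counterclockwise: the last clause says that [normal w i] is the
   outward unit normal along the i-th edge. *)
Definition polygon (R : realType) (w : seq (R * R)) (K : set (R * R)) : Prop :=
  [/\ (2 < size w)%N,
      forall i j (s t : R), (i < size w)%N -> (j < size w)%N ->
        0 <= s < 1 -> 0 <= t < 1 ->
        edge_pt w i s = edge_pt w j t -> i = j /\ s = t,
      compact K,
      K `\` K° = \bigcup_(i in [set i | (i < size w)%N]) edge w i &
      forall i (t : R), (i < size w)%N -> 0 < t < 1 ->
        \forall s \near (0 : R)^'+,
          K° (edge_pt w i t - s *: normal w i) /\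
          ~ K (edge_pt w i t + s *: normal w i)].

Definition convex_polygonal_domain (R : realType) (w : seq (R * R))
    (Omega : set (R * R)) : Prop :=
  [/\ open Omega, convex_set Omega & polygon w (closure Omega)].

Definition arcint (R : realType) (w : seq (R * R)) (A : set (R * R))
    (f : R * R -> R) : \bar R :=
  (\sum_(i < size w) (elen (edge_vec w i))%:E *
     \int[leb1]_(t in [set t : R | (0 <= t <= 1)%R /\ A (edge_pt w i t)])
       (f (edge_pt w i t))%:E)%E.
Definition arclen (R : realType) (w : seq (R * R)) (A : set (R * R)) : \bar R :=
  arcint w A (cst 1).

(* Zero trace on GammaD: v is an H^1-limit of functions that are smooth up to
   the boundary and whose restrictions to GammaD tend to 0 in L2(GammaD); by
   continuity of the trace operator this means that the trace of v vanishes
   almost everywhere on GammaD. *)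
Definition zero_trace (R : realType) (Omega : set (R * R)) (w : seq (R * R))
    (GammaD : set (R * R)) (v : jet R) : Prop :=
  exists phi : nat -> R * R -> R,
    [/\ forall n, smooth (phi n),
        L2norm Omega (fun x => phi n x - v.1 x) @[n --> \oo] --> 0%E,
        L2norm Omega (fun x => (gradf (phi n) x).1 - (v.2 x).1) @[n --> \oo]
          --> 0%E,
        L2norm Omega (fun x => (gradf (phi n) x).2 - (v.2 x).2) @[n --> \oo]
          --> 0%E &
        arcint w GammaD (fun x => phi n x ^+ 2) @[n --> \oo] --> 0%E].

Definition H1D (R : realType) (Omega : set (R * R)) (w : seq (R * R))
    (GammaD : set (R * R)) : set (jet R) :=
  [set v | H1 Omega v /\
     if arclen w GammaD == 0%E then \int[leb2]_(x in Omega) v.1 x = 0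
     else zero_trace Omega w GammaD v].

Definition spd (R : realType) (A : 'M[R]_2) : Prop :=
  A^T = A /\ forall u : R * R, u != 0 -> 0 < dot (mulv A u) u.

Definition coefficient (R : realType) (Omega : set (R * R))
    (Lambda : R * R -> 'M[R]_2) : Prop :=
  [/\ forall i j, Linf Omega (fun x => Lambda x i j),
      {ae leb2, forall x, Omega x -> spd (Lambda x)} &
      exists2 c : R, 0 < c &
        {ae leb2, forall x, Omega x ->
           forall l, eigenvalue (Lambda x) l -> c <= l}].

Definition aform (R : realType) (Omega : set (R * R))
    (Lambda : R * R -> 'M[R]_2) (u v : jet R) : R :=
  \int[leb2]_(x in Omega) dot (mulv (Lambda x) (u.2 x)) (v.2 x).
Definition anorm (R : realType) (Omega : set (R * R))
    (Lambda : R * R -> 'M[R]_2) (v : jet R) : R :=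
  Num.sqrt (aform Omega Lambda v v).
Definition Fform (R : realType) (Omega : set (R * R)) (q : R * R -> R)
    (v : jet R) : R :=
  \int[leb2]_(x in Omega) (q x * v.1 x).

Definition H1divL (R : realType) (Omega : set (R * R)) (w : seq (R * R))
    (GammaD : set (R * R)) (Lambda : R * R -> 'M[R]_2) : set (jet R) :=
  [set v | H1D Omega w GammaD v /\
     in_Hdiv Omega (fun x => mulv (Lambda x) (v.2 x))].

(* [Square x u] has the vertex x and the sides u and rot90 u issuing from it. *)
Inductive cell (R : realType) :=
  | Triangle of R * R & R * R & R * R
  | Square of R * R & R * R.

Definition cell_nodes (R : realType) (c : cell R) : seq (R * R) :=
  match c with
  | Triangle x y z => [:: x; y; z]
  | Square x u => [:: x; x + u; x + u + rot90 u; x + rot90 u]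
  end.

Definition nondegenerate_cell (R : realType) (c : cell R) : Prop :=
  match c with
  | Triangle x y z => dot (rot90 (y - x)) (z - x) != 0
  | Square x u => u != 0
  end.

Definition cell_set (R : realType) (c : cell R) : set (R * R) :=
  match c with
  | Triangle x y z =>
      [set p | exists s t : R, [/\ 0 <= s, 0 <= t, s + t <= 1 &
                                p = x + s *: (y - x) + t *: (z - x)]]
  | Square x u =>
      [set p | exists s t : R, [/\ 0 <= s <= 1, 0 <= t <= 1 &
                                p = x + s *: u + t *: rot90 u]]
  end.

(* Polynomials of total degree at most r for a triangle; of degree at most r in
   each of the two coordinates attached to the sides for a square. *)
Definition local_poly (R : realType) (r : nat) (c : cell R) (f : R * R -> R) :=
  match c with
  | Triangle _ _ _ => exists a : nat -> nat -> R, forall p,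
      f p = \sum_(i < r.+1) \sum_(j < r.+1 | (i + j <= r)%N)
              a i j * p.1 ^+ i * p.2 ^+ j
  | Square x u => exists a : nat -> nat -> R, forall s t : R,
      f (x + s *: u + t *: rot90 u) =
        \sum_(i < r.+1) \sum_(j < r.+1) a i j * s ^+ i * t ^+ j
  end.

Definition triangulation (R : realType) (Omega : set (R * R)) (N : nat)
    (T : 'I_N -> cell R) : Prop :=
  [/\ forall l, nondegenerate_cell (T l),
      closure Omega = \bigcup_l cell_set (T l) &
      forall l m, l != m ->
        let I := cell_set (T l) `&` cell_set (T m) in
        [\/ I = set0,
            exists x, [/\ x \in cell_nodes (T l), x \in cell_nodes (T m) &
                          I = [set x]] |
            exists i j, [/\ (i < size (cell_nodes (T l)))%N,
                            (j < size (cell_nodes (T m)))%N,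
                            I = edge (cell_nodes (T l)) i &
                            I = edge (cell_nodes (T m)) j]]].

Definition mesh_vertex (R : realType) (N : nat) (T : 'I_N -> cell R)
    : set (R * R) :=
  [set x | exists l, x \in cell_nodes (T l)].

Definition pieces (R : realType) (r N : nat) (T : 'I_N -> cell R)
    (v : R * R -> R) (f : 'I_N -> R * R -> R) : Prop :=
  forall l, local_poly r (T l) (f l) /\ {in cell_set (T l), v =1 f l}.

Definition Ph (R : realType) (Omega : set (R * R)) (r N : nat)
    (T : 'I_N -> cell R) : set (jet R) :=
  [set v | {within closure Omega, continuous v.1} /\
     exists f, pieces r T v.1 f].

Definition PhD (R : realType) (Omega : set (R * R)) (w : seq (R * R))
    (GammaD : set (R * R)) (r N : nat) (T : 'I_N -> cell R) : set (jet R) :=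
  Ph Omega r T `&` H1D Omega w GammaD.

(* For every primal vertex x, [V x] is the associated (closed) control volume
   and [bV x] the list of its corners. *)
Definition dual_partition (R : realType) (Omega : set (R * R)) (N : nat)
    (T : 'I_N -> cell R) (V : R * R -> set (R * R))
    (bV : R * R -> seq (R * R)) : Prop :=
  [/\ forall x, mesh_vertex T x ->
        [/\ polygon (bV x) (V x), V x x & V x `<=` closure Omega],
      closure Omega = \bigcup_(x in mesh_vertex T) V x &
      forall x y, mesh_vertex T x -> mesh_vertex T y -> x <> y ->
        (V x)° `&` (V y)° = set0].

(* [z] enumerates, without repetition, the vertices whose control volume
   belongs to the dual mesh. *)
Definition dual_enumeration (R : realType) (w : seq (R * R))
    (GammaD : set (R * R)) (N : nat) (T : 'I_N -> cell R)
    (V : R * R -> set (R * R)) (Ns : nat) (z : 'I_Ns -> R * R) : Prop :=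
  injective z /\
  range z = [set x | mesh_vertex T x /\ arclen w (V x `&` GammaD) = 0%E].

(* Parameters of the points of the i-th edge that are reached from inside the
   curve through the cell C. Along a curve crossing the primal edges in
   finitely many points this is, up to finitely many parameters, the part of
   the edge lying in C. *)
Definition edge_part (R : realType) (w : seq (R * R)) (i : nat)
    (C : set (R * R)) : set R :=
  [set t | 0 <= t <= 1 /\
     \forall s \near (0 : R)^'+, C (edge_pt w i t - s *: normal w i)].

Definition flux_density (R : realType) (Lambda : R * R -> 'M[R]_2)
    (w : seq (R * R)) (i : nat) (f : R * R -> R) (t : R) : R :=
  - dot (mulv (Lambda (edge_pt w i t)) (gradf f (edge_pt w i t))) (normal w i).

Definition flux_integrable (R : realType) (Lambda : R * R -> 'M[R]_2) (N : nat)
    (T : 'I_N -> cell R) (w : seq (R * R)) (f : 'I_N -> R * R -> R) : Prop :=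
  forall i l, (i < size w)%N ->
    leb1.-integrable (edge_part w i (cell_set (T l)))
      (EFin \o flux_density Lambda w i (f l)).

Definition flux (R : realType) (Lambda : R * R -> 'M[R]_2) (N : nat)
    (T : 'I_N -> cell R) (w : seq (R * R)) (f : 'I_N -> R * R -> R) : R :=
  \sum_(i < size w) \sum_(l < N) elen (edge_vec w i) *
    \int[leb1]_(t in edge_part w i (cell_set (T l)))
      flux_density Lambda w i (f l) t.

Definition lin_span (R : realType) (E : lmodType R) (S : set E) : set E :=
  [set v | forall W : set E, W 0 ->
     (forall (c : R) x y, W x -> W y -> W (c *: x + y)) -> S `<=` W -> W v].

Definition Vh (R : realType) (Omega : set (R * R)) (w : seq (R * R))
    (GammaD : set (R * R)) (Lambda : R * R -> 'M[R]_2) (r N : nat)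
    (T : 'I_N -> cell R) : set (jet R) :=
  lin_span (PhD Omega w GammaD r T `|` H1divL Omega w GammaD Lambda).

(* A multiplier is the row vector of its values on the control volumes
   [V (z k)]. A form [abar] is the total flux form when it is bilinear on
   Vh x Mh and is given on H1divL through the divergence and on PhD through the
   fluxes of the polynomial pieces. The volumes are intersected with Omega
   only because fields are meaningless outside Omega. *)
Definition total_flux_form (R : realType) (Omega : set (R * R))
    (w : seq (R * R)) (GammaD : set (R * R)) (Lambda : R * R -> 'M[R]_2)
    (r N : nat) (T : 'I_N -> cell R) (V : R * R -> set (R * R))
    (bV : R * R -> seq (R * R)) (Ns : nat) (z : 'I_Ns -> R * R)
    (abar : jet R -> 'rV[R]_Ns -> R) : Prop :=
  [/\ forall (c : R) u v m, Vh Omega w GammaD Lambda r T u ->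
        Vh Omega w GammaD Lambda r T v ->
        abar (c *: u + v) m = c * abar u m + abar v m,
      forall (c : R) v m n, Vh Omega w GammaD Lambda r T v ->
        abar v (c *: m + n) = c * abar v m + abar v n,
      forall v d m, H1divL Omega w GammaD Lambda v ->
        weak_div Omega (fun x => mulv (Lambda x) (v.2 x)) d ->
        abar v m =
          \sum_(k < Ns) m 0 k * - \int[leb2]_(x in V (z k) `&` Omega) d x &
      forall v f, PhD Omega w GammaD r T v -> pieces r T v.1 f ->
        (forall k, flux_integrable Lambda T (bV (z k)) f) /\
        forall m, abar v m =
          \sum_(k < Ns) m 0 k * flux Lambda T (bV (z k)) f].

Definition Fbar (R : realType) (Omega : set (R * R)) (q : R * R -> R)
    (V : R * R -> set (R * R)) (Ns : nat) (z : 'I_Ns -> R * R)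
    (m : 'rV[R]_Ns) : R :=
  \sum_(k < Ns) m 0 k * \int[leb2]_(x in V (z k) `&` Omega) q x.

(* Z is the set of representatives of 0: norms are on classes modulo Z. *)
Definition norm_on (R : realType) (E : lmodType R) (V Z : set E) (N : E -> R) :=
  [/\ forall v, V v -> 0 <= N v,
      forall v, V v -> (N v = 0 <-> Z v),
      forall (c : R) v, V v -> N (c *: v) = `|c| * N v &
      forall u v, V u -> V v -> N (u + v) <= N u + N v].

Definition inf_sup (R : realType) (E M : lmodType R) (X Z : set E)
    (b : E -> M -> R) (nE : E -> R) (nM : M -> R) : \bar R :=
  ereal_inf [set ereal_sup [set (b v m / (nE v * nM m))%:E | v in X `\` Z]
            | m in [set m | m != 0]].

Definition saddle_point (R : realType) (E M : lmodType R) (X : set E)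
    (a : E -> E -> R) (b : E -> M -> R) (F : E -> R) (G : M -> R)
    (u : E) (l : M) : Prop :=
  [/\ X u, forall v, X v -> a u v + b v l = F v & forall m, b u m = G m].

(* Main.v *)
Require Import Defs.
From HB Require Import structures.
From mathcomp Require Import all_boot all_order all_algebra.
From mathcomp Require Import all_classical all_reals all_analysis.
From mathcomp Require Import measurable_realfun ess_sup_inf ring.

Set Implicit Arguments.
Unset Strict Implicit.
Unset Printing Implicit Defensive.

Import Order.TTheory GRing.Theory Num.Theory.
Import numFieldNormedType.Exports.

Local Open Scope classical_set_scope.
Local Open Scope ring_scope.

(** Two arguments are combined.

    The continuous problem. If phi is a test function on Omega, then phi, or
    phi minus its mean when the Dirichlet part has length zero, is admissible
    in the weak formulation, and subtracting the mean changes neither the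
    gradient nor the right-hand side, since q then has zero integral. Testing
    with it says that Lambda grad p has weak divergence - q
    ([solution_weak_div]). This puts p in H1divL, and the total flux of p
    through a control volume is then the integral of q over it, so that (p, 0)
    solves the saddle point problem. The analytic content is the
    admissibility of phi: it has to be a Sobolev function in the sense of the
    definition, which is integration by parts against another test function ([integration_by_parts_test]), that is, Fubini and the
    fundamental theorem of calculus on lines
    ([integral_partial_compact_support]).

    The error estimate. Write e = p - ph and let l be the discrete multiplier.
    Subtracting the two problems gives a(e, y) = abar(y, l) for y discrete,
    and abar(e, l) = 0. The first equation and the inf-sup condition bound
    alpha |l| by the energy norm of e, because the multiplier is controlled by
    the residual it represents ([inf_sup_le]). For every discrete v, both
    equations together give
      a(e, e) = a(e, p - v) + a(e, v) - a(e, ph)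
              = a(e, p - v) + abar(v, l) - abar(ph, l)
              = a(e, p - v) - abar(p - v, l),
    and the two terms are at most |e| |p - v| and
    |abar| |p - v| |e| / alpha. Dividing by |e| gives the estimate
    ([saddle_point_quasi_optimal]), with constant 1 + |abar| / alpha, half
    of the one in the theorem. *)

(* The plane as leb2 sees it: R * R with the product of the sigma-algebras
   generated by the half-open intervals. *)
Local Notation plane R := (measurableTypeR R * measurableTypeR R)%type.

(** * Square integrable functions *)

Section Lfun2.
Context d (T : measurableType d) (R : realType).
Variable mu : {measure set T -> \bar R}.

Lemma Lfun2_sqr_integrable (f : T -> R) :
  measurable_fun [set: T] f ->
  mu.-integrable [set: T] (EFin \o (fun x => f x ^+ 2)) -> f \in Lfun mu 2%:E.
Proof.
move=> mf /integrableP[_ f2oo]; apply/andP; split; rewrite inE//=.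
rewrite /finite_norm unlock /Lnorm poweR_lty//.
apply: le_lt_trans f2oo; rewrite le_eqVlt; apply/orP; left; apply/eqP.
apply: eq_integral => x _ /=.
by rewrite powR_mulrn// normrX.
Qed.

(** On a space of measure zero the norm of exponent +oo is 0 by convention, and
    every bound holds almost everywhere. *)
Lemma Lfun_oo_ae_bounded (g : T -> R) : g \in Lfun mu +oo%E ->
  exists M : R, \forall x \ae mu, `|g x| <= M.
Proof.
case/andP => _; rewrite inE/= /finite_norm unlock /Lnorm.
case: ifPn => [_|]; first exact: ess_supr_bounded.
rewrite -leNgt => muT _; exists 0; exists setT; split => //.
by apply/eqP; rewrite eq_le muT measure_ge0.
Qed.

(** This is what makes the flux Lambda grad v square integrable. *)
Lemma Lfun2_mul_ae_bounded (g f : T -> R) (M : R) :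
  measurable_fun [set: T] g -> (\forall x \ae mu, `|g x| <= M) ->
  f \in Lfun mu 2%:E -> g \* f \in Lfun mu 2%:E.
Proof.
move=> mg gM f2; have /andP[/[!inE]/= mf _] := f2.
apply: Lfun2_sqr_integrable; first exact: measurable_funM.
have /integrableP[mf2 f2oo] := Lfun2_integrable_sqr f2.
have mgf2 : measurable_fun [set: T] (fun x => (g x * f x) ^+ 2).
  by apply: measurable_funX; exact: measurable_funM.
apply/integrableP; split; first exact/measurable_EFinP.
have M2f2oo : (\int[mu]_x ((M ^+ 2)%:E * `|(f x ^+ 2)%:E|) < +oo)%E.
  rewrite ge0_integralZl//; last by rewrite lee_fin sqr_ge0.
    by rewrite lte_mul_pinfty// lee_fin sqr_ge0.
  exact: measurableT_comp.
apply: le_lt_trans M2f2oo.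
apply: ae_ge0_le_integral => //.
- exact/measurableT_comp/measurable_EFinP.
- by move=> x _; rewrite mule_ge0// lee_fin sqr_ge0.
- by apply: measurable_funeM; exact: measurableT_comp.
- apply: filterS gM => x gxM _ /=.
  rewrite -EFinM lee_fin exprMn normrM ler_wpM2r//.
  by rewrite normrX ler_sqr ?nnegrE//; exact: le_trans gxM.
Qed.

End Lfun2.

(** * Measurability and integration by parts in the plane *)

Section plane_measurability.
Context {R : realType}.

Lemma ball_planeE (x : R * R) e : ball x e = ball x.1 e `*` ball x.2 e.
Proof. by apply/seteqP; split => y. Qed.

(** An open set is a union of squares with rational centres and radii of the
    form 1/(n + 1), and these form a countable family. *)
Lemma open_measurable_plane (U : set (R * R)) :
  open U -> measurable (U : set (plane R)).
Proof.
move=> oU.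
pose box (i : rat * rat * nat) : set (plane R) :=
  ball (ratr i.1.1 : R) i.2.+1%:R^-1 `*` ball (ratr i.1.2 : R) i.2.+1%:R^-1.
(* Squares that are not inside U are replaced by the empty set, so that the
   union ranges over a whole countable type. *)
pose F (i : rat * rat * nat) : set (plane R) :=
  if `[< box i `<=` U >] then box i else set0.
suff -> : U = \bigcup_i F i.
  apply: countable_bigcupT_measurable => // i.
  rewrite /F; case: ifPn => // _.
  by apply: measurableX; exact: measurable_ball.
apply/seteqP; split => x; last first.
  by move=> [i _]; rewrite /F; case: ifPn => // /asboolP; exact.
move=> Ux; have /nbhs_ballP[e /= e0 xeU] : nbhs x U by exact: open_nbhs_nbhs.
(* Radius below e / 2: a square containing x has diameter below e. *)
have [n _ /(_ _ (leqnn n)) ne] :=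
  near_infty_natSinv_lt (PosNum (divr_gt0 e0 (ltr0n R 2))).
rewrite /= in ne.
have n0 : (0 : R) < n.+1%:R^-1 by rewrite invr_gt0 ltr0n.
have near y : exists q : rat, ball (ratr q : R) n.+1%:R^-1 y.
  have yn : y - n.+1%:R^-1 < y + n.+1%:R^-1.
    by rewrite ltrD2l (lt_trans _ n0)// oppr_lt0.
  have [q] := rat_in_itvoo yn.
  rewrite in_itv/= => yq; exists q.
  by rewrite /ball/= ltr_distl.
have [q1 xq1] := near x.1; have [q2 xq2] := near x.2.
exists (q1, q2, n) => //; rewrite /F ifT//; apply/asboolP => y [/= y1 y2].
have near_ball (t u c : R) : ball c n.+1%:R^-1 t -> ball c n.+1%:R^-1 u ->
    ball t e u.
  move=> ct cu; apply: (@ball_split _ _ c).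
    by apply: le_ball (ball_sym ct); exact: ltW.
  by apply: le_ball cu; exact: ltW.
by apply: xeU; rewrite ball_planeE; split;
  [exact: near_ball xq1 y1|exact: near_ball xq2 y2].
Qed.

Lemma continuous_measurable_plane (f : R * R -> R) :
  continuous f -> measurable_fun [set: plane R] f.
Proof.
move=> cf; apply: (measurability (@RGenOpens.G R)).
  exact: RGenOpens.measurableE.
move=> _ [_ [a [b ->] <-]]; rewrite setTI.
apply: open_measurable_plane.
by move/continuousP : cf; apply; exact: interval_open.
Qed.
End plane_measurability.

Section compact_support.
Context {R : realType}.
Implicit Types (f : R * R -> R) (K : set (R * R)).

Lemma compact_closed_plane K : compact K -> closed K.
Proof. by apply: compact_closed; exact: norm_hausdorff. Qed.

(** The inequalities are strict so that the support lies in the interior of the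
    box, and functions supported in K vanish on its sides. *)
Lemma compact_box K : compact K ->
  exists2 M : R, 0 < M & forall x, K x -> `|x.1| < M /\ `|x.2| < M.
Proof.
move=> /compact_bounded[M [_ KM]]; exists (`|M| + 2).
  by rewrite ltr_wpDl.
move=> x Kx; have := KM (`|M| + 1) _ _ Kx.
rewrite (le_lt_trans (ler_norm M)) ?ltrDl// => /(_ isT).
rewrite /= prod_normE ge_max => /andP[x1 x2].
by split; rewrite (le_lt_trans x1, le_lt_trans x2)// ltrD2l ltr1n.
Qed.

Lemma compact_measurable_plane K :
  compact K -> measurable (K : set (plane R)).
Proof.
move=> /compact_closed_plane/closed_openC/open_measurable_plane/measurableC.
by rewrite setCK.
Qed.

Lemma leb2_fin_sub_compact (A : set (plane R)) K : measurable A -> compact K ->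
  A `<=` K -> (leb2 A < +oo)%E.
Proof.
move=> mA /compact_box[M M0 KM] AK.
have mI : measurable (`]-M, M[ : set (measurableTypeR R)).
  exact: measurable_itv.
apply: (@le_lt_trans _ _ (leb2 (`]-M, M[ `*` `]-M, M[ : set (plane R)))).
  apply: le_measure; rewrite ?inE//; first exact: measurableX.
  by move=> x /AK /KM[x1 x2]; split => /=; rewrite in_itv/= -ltr_norml.
have lI : (lebesgue_measure (`](- M)%R, M[ : set R) < +oo)%E.
  by rewrite lebesgue_measure_itv/=; case: ifP => // _; rewrite -EFinD ltry.
by rewrite product_measure1E// lte_mul_pinfty// ge0_fin_numE.
Qed.

Lemma compact_support_integrable f K : continuous f -> compact K ->
  (forall x, ~ K x -> f x = 0) -> leb2.-integrable setT (EFin \o f).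
Proof.
move=> cf cK f0.
have mK := compact_measurable_plane cK.
have mf := continuous_measurable_plane cf.
have -> : EFin \o f = (EFin \o f) \_ K.
  apply/funext => x; rewrite patchE; case: ifPn => // /negP xK.
  by rewrite /= f0// => Kx; apply: xK; rewrite inE.
apply: (integrable_mkcond _ _).1 => //.
apply: measurable_bounded_integrable => //.
- exact: leb2_fin_sub_compact cK _.
- exact: measurable_funTS.
- have : compact (f @` K).
    by apply: continuous_compact => //; exact: continuous_subspaceT.
  move=> /compact_bounded[M [Mr fM]]; exists M; split => // N MN x Kx.
  by apply: (fM N MN); exists x.
Qed.

Lemma compact_support_Lfun2 f K : continuous f -> compact K ->
  (forall x, ~ K x -> f x = 0) -> f \in Lfun leb2 2%:E.
Proof.
move=> cf cK f0; apply: Lfun2_sqr_integrable.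
  exact: continuous_measurable_plane.
apply: (compact_support_integrable _ cK) => [x|x /f0 ->]; last first.
  by rewrite expr0n.
by under eq_fun do rewrite expr2; apply: (@continuousM _ _ f f); exact: cf.
Qed.

Lemma derive_off_support f K e x : closed K ->
  (forall x, ~ K x -> f x = 0) -> ~ K x -> 'D_e f x = 0.
Proof.
move=> cK f0 Kx.
have -> : 'D_e f x = 'D_e (cst 0 : R * R -> R) x.
  apply: near_eq_derive; apply: filterS (f0) _.
  by apply: open_nbhs_nbhs; split => //; exact: closed_openC.
by rewrite derive_cst.
Qed.

(** The two vanishing hypotheses include the end points of [-M, M], so that the
    fundamental theorem of calculus on that segment gives g M - g (-M) = 0. *)
Lemma integral_derive_compact_support (g : R -> R) (M : R) : 0 < M ->
  (forall t, derivable g t 1) -> continuous (fun t => 'D_1 g t) ->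
  (forall t, M <= `|t| -> g t = 0) ->
  (forall t, M <= `|t| -> 'D_1 g t = 0) ->
  (\int[lebesgue_measure]_t ('D_1 g t)%:E = 0)%E.
Proof.
move=> M0 dg cg g0 g'0.
transitivity (\int[lebesgue_measure]_(t in `[(- M)%R, M]) ('D_1 g t)%:E)%E.
  rewrite [RHS]integral_mkcond; apply: eq_integral => t _.
  rewrite patchE; case: ifPn => // /negP tM; rewrite g'0//.
  rewrite leNgt; apply/negP => tM'; apply: tM; rewrite inE/= in_itv/=.
  by rewrite -ler_norml ltW.
have cgg : continuous g.
  by move=> t; apply/differentiable_continuous; rewrite -derivable1_diffP.
rewrite (@continuous_FTC2 _ _ g).
- by rewrite !g0 ?subee// ?normrN gtr0_norm.
- by rewrite gtrN.
- exact: continuous_subspaceT.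
- split => //.
    by apply: cvg_at_right_filter; exact: cgg.
  by apply: cvg_at_left_filter; exact: cgg.
- by move=> t _; rewrite derive1E.
Qed.

Let shift_fst (h t y : R) :
  h *: ((1, 0) : R * R) + (t, y) = (h%:A + t, y).
Proof. by rewrite -[in RHS](add0r y) -[in RHS](scaler0 R^o h). Qed.

Let shift_snd (h t y : R) :
  h *: ((0, 1) : R * R) + (y, t) = (y, h%:A + t).
Proof. by rewrite -[in RHS](add0r y) -[in RHS](scaler0 R^o h). Qed.

Let pair_fst_continuous (y : R) : continuous (fun s : R => (s, y) : R * R).
Proof.
move=> t; exact: (@cvg_pair _ _ _ (nbhs t) (nbhs t) (nbhs y) _ _ _
  (fun s => s) (fun=> y) cvg_id (cvg_cst y)).
Qed.

Let pair_snd_continuous (y : R) : continuous (fun s : R => (y, s) : R * R).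
Proof.
move=> t; exact: (@cvg_pair _ _ _ (nbhs t) (nbhs y) (nbhs t) _ _ _
  (fun=> y) (fun s => s) (cvg_cst y) cvg_id).
Qed.

(** Fubini: on each line parallel to e the integrand is the derivative of a
    compactly supported function of one variable. *)
Lemma integral_partial_compact_support f K e : e = (1, 0) \/ e = (0, 1) ->
  compact K -> (forall x, ~ K x -> f x = 0) ->
  (forall x, derivable f x e) -> continuous (fun x => 'D_e f x) ->
  \int[leb2]_x 'D_e f x = 0.
Proof.
move=> e01 cK f0 df cdf.
have clK := compact_closed_plane cK.
have [M M0 KM] := compact_box cK.
have df0 x : ~ K x -> 'D_e f x = 0 by exact: derive_off_support.
have idf : leb2.-integrable setT (EFin \o (fun x => 'D_e f x)).
  exact: compact_support_integrable cK _.
rewrite /Rintegral.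
case: e01 df cdf df0 idf => -> df cdf df0 idf.
(* Integrate first along the direction of e, whichever coordinate that is. *)
- rewrite -(integral21_prod_meas1 idf).
  rewrite (_ : fubini_G _ _ = cst 0%E) ?integral0//.
  apply/funext => y; rewrite /fubini_G/=.
  have slice t :
      (fun h => h^-1 *: ((f \o shift (t, y)) (h *: (1, 0)) - f (t, y))) =
      (fun h => h^-1 *:
         (((fun s => f (s, y)) \o shift t) (h *: 1) - f (t, y))).
    by apply/funext => h /=; rewrite -shift_fst.
  have sliceD t : 'D_(1, 0) f (t, y) = 'D_1 (fun s => f (s, y)) t.
    by rewrite /derive slice.
  under eq_integral do rewrite sliceD.
  apply: (@integral_derive_compact_support _ M) => //.
  + by move=> t; have := df (t, y); rewrite /derivable slice.
  + under eq_fun do rewrite -sliceD.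
    move=> t; apply: (@continuous_comp _ _ _ (fun s : R => (s, y) : R * R)
      (fun x => 'D_(1, 0) f x)); last exact: cdf.
    exact: pair_fst_continuous.
  + by move=> t Mt; apply: f0 => /KM[/= + _]; rewrite ltNge Mt.
  + by move=> t Mt; rewrite -sliceD df0// => /KM[/= + _]; rewrite ltNge Mt.
- rewrite -(integral12_prod_meas1 idf).
  rewrite (_ : fubini_F _ _ = cst 0%E) ?integral0//.
  apply/funext => y; rewrite /fubini_F/=.
  have slice t :
      (fun h => h^-1 *: ((f \o shift (y, t)) (h *: (0, 1)) - f (y, t))) =
      (fun h => h^-1 *:
         (((fun s => f (y, s)) \o shift t) (h *: 1) - f (y, t))).
    by apply/funext => h /=; rewrite -shift_snd.
  have sliceD t : 'D_(0, 1) f (y, t) = 'D_1 (fun s => f (y, s)) t.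
    by rewrite /derive slice.
  under eq_integral do rewrite sliceD.
  apply: (@integral_derive_compact_support _ M) => //.
  + by move=> t; have := df (y, t); rewrite /derivable slice.
  + under eq_fun do rewrite -sliceD.
    move=> t; apply: (@continuous_comp _ _ _ (fun s : R => (y, s) : R * R)
      (fun x => 'D_(0, 1) f x)); last exact: cdf.
    exact: pair_snd_continuous.
  + by move=> t Mt; apply: f0 => /KM[/= _ +]; rewrite ltNge Mt.
  + by move=> t Mt; rewrite -sliceD df0// => /KM[/= _ +]; rewrite ltNge Mt.
Qed.

End compact_support.

(** * Square integrability on a domain *)

Section L2_on.
Context {R : realType}.
Variable Omega : set (R * R).
Implicit Types f g : R * R -> R.

Lemma restrictE f x : (f \_ Omega) x = if x \in Omega then f x else 0.
Proof. by rewrite patchE. Qed.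

Lemma restrict_support f K : K `<=` Omega -> (forall x, ~ K x -> f x = 0) ->
  f \_ Omega = f.
Proof.
move=> KO f0; apply/funext => x; rewrite restrictE; case: ifPn => // /negP xO.
by rewrite f0// => /KO Ox; apply: xO; rewrite inE.
Qed.

Lemma L2D f g : L2 Omega f -> L2 Omega g -> L2 Omega (fun x => f x + g x).
Proof.
rewrite /L2 => f2 g2.
have -> : (fun x => f x + g x) \_ Omega = (f \_ Omega) \+ (g \_ Omega).
  apply/funext => x; rewrite /= !restrictE.
  by case: ifPn; rewrite ?addr0.
have p1 : (1 <= 2%:E :> \bar R)%E by rewrite lee_fin ler1n.
exact: (Lfun_addr_closed leb2 p1).2.
Qed.

Lemma L2Z c f : L2 Omega f -> L2 Omega (fun x => c * f x).
Proof.
rewrite /L2 => f2.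
have -> : (fun x => c * f x) \_ Omega = c \o* (f \_ Omega).
  apply/funext => x; rewrite /= !restrictE mulrC.
  by case: ifPn; rewrite ?mul0r.
by apply: Lfun_scale => //; rewrite ler1n.
Qed.

Lemma L2N f : L2 Omega f -> L2 Omega (fun x => - f x).
Proof. by move=> /(L2Z (-1)); under eq_fun do rewrite mulN1r. Qed.

Hypothesis oO : open Omega.
Let mO : measurable (Omega : set (plane R)) := open_measurable_plane oO.

Lemma L2_measurable f : L2 Omega f -> measurable_fun (Omega : set (plane R)) f.
Proof. by case/andP => /[!inE] /= mf _; apply/measurable_restrictT. Qed.

Lemma L2_mul_integrable f g : L2 Omega f -> L2 Omega g ->
  leb2.-integrable (Omega : set (plane R)) (EFin \o (fun x => f x * g x)).
Proof.
move=> f2 g2; apply: (integrable_mkcond _ _).2 => //.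
rewrite restrict_EFin.
have -> : (fun x => f x * g x) \_ Omega = (f \_ Omega) \* (g \_ Omega).
  apply/funext => x; rewrite /= !restrictE.
  by case: ifPn; rewrite ?mulr0.
by apply/Lfun1_integrable; exact: Lfun2_mul_Lfun1.
Qed.

Lemma L2_Linf_mul g f : Linf Omega g -> L2 Omega f ->
  L2 Omega (fun x => g x * f x).
Proof.
rewrite /L2 => gb f2.
have -> : (fun x => g x * f x) \_ Omega = (g \_ Omega) \* (f \_ Omega).
  apply/funext => x; rewrite /= !restrictE.
  by case: ifPn; rewrite ?mulr0.
have [M gM] := Lfun_oo_ae_bounded gb.
have /andP[/[!inE]/= mg _] := gb.
exact: Lfun2_mul_ae_bounded gM f2.
Qed.

Hypothesis finO : (leb2 (Omega : set (plane R)) < +oo)%E.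

Lemma L2_cst (c : R) : L2 Omega (fun=> c).
Proof.
apply: Lfun2_sqr_integrable.
  by apply: (measurable_restrictT _ mO).1; exact: measurable_cst.
have -> : EFin \o (fun x => ((fun=> c) \_ Omega) x ^+ 2) =
    (EFin \o (fun=> c ^+ 2)) \_ Omega.
  rewrite restrict_EFin; apply/funext => x /=.
  by rewrite !restrictE; case: ifPn; rewrite // expr0n.
apply: (integrable_mkcond _ _).1 => //.
apply/integrableP; split; first exact: measurable_cst.
by under eq_integral do rewrite /=; rewrite integral_cst// lte_mul_pinfty.
Qed.

Lemma L2_integrable f : L2 Omega f ->
  leb2.-integrable (Omega : set (plane R)) (EFin \o f).
Proof.
move=> f2; have := L2_mul_integrable f2 (L2_cst 1).
by under eq_fun do rewrite mulr1.
Qed.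

End L2_on.

(** * Test functions are admissible *)

Section test_functions.
Context {R : realType}.
Variable Omega : set (R * R).
Hypothesis oO : open Omega.
Let mO : measurable (Omega : set (plane R)) := open_measurable_plane oO.
Implicit Types phi psi g : R * R -> R.

Lemma smooth_continuous phi : smooth phi -> continuous phi.
Proof. by move=> /(_ 0). Qed.

Lemma smooth_partial phi (e : R * R) : smooth phi -> e = (1, 0) \/ e = (0, 1) ->
  (forall x, derivable phi x e) /\ continuous (fun x => 'D_e phi x).
Proof. by move=> /(_ 1) + he => /(_ e he). Qed.

Lemma test_fun_L2 phi : test_fun Omega phi -> L2 Omega phi.
Proof.
move=> [sphi [K [cK KO phi0]]]; rewrite /L2 (restrict_support KO phi0).
exact: compact_support_Lfun2 (smooth_continuous sphi) cK phi0.
Qed.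

Lemma test_fun_partial_L2 phi (e : R * R) : test_fun Omega phi ->
  e = (1, 0) \/ e = (0, 1) -> L2 Omega (fun x => 'D_e phi x).
Proof.
move=> [sphi [K [cK KO phi0]]] he.
have d0 x : ~ K x -> 'D_e phi x = 0.
  exact: derive_off_support (compact_closed_plane cK) phi0.
rewrite /L2 (restrict_support KO d0).
exact: compact_support_Lfun2 (smooth_partial sphi he).2 cK d0.
Qed.

(** The boundary term vanishes because of the support of psi, so g may be a test
    function minus a constant. *)
Lemma integration_by_parts_test g g' psi (e : R * R) :
  e = (1, 0) \/ e = (0, 1) -> continuous g ->
  (forall x, is_derive x e g (g' x)) -> continuous g' ->
  test_fun Omega psi ->
  \int[leb2]_(x in Omega) (g x * 'D_e psi x)
    = - \int[leb2]_(x in Omega) (g' x * psi x).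
Proof.
move=> he cg dg cg' [spsi [K [cK KO psi0]]].
have cpsi := smooth_continuous spsi.
have [dpsi cdpsi] := smooth_partial spsi he.
have dpsi0 x : ~ K x -> 'D_e psi x = 0.
  exact: derive_off_support (compact_closed_plane cK) psi0.
have s1 x : ~ K x -> g x * 'D_e psi x = 0 by move=> /dpsi0 ->; rewrite mulr0.
have s2 x : ~ K x -> g' x * psi x = 0 by move=> /psi0 ->; rewrite mulr0.
rewrite Rintegral_mkcond (restrict_support KO s1).
rewrite [in RHS]Rintegral_mkcond (restrict_support KO s2).
have c1 : continuous (fun x => g x * 'D_e psi x).
  by move=> x; apply: (@continuousM _ _ g (fun x => 'D_e psi x));
    [exact: cg|exact: cdpsi].
have c2 : continuous (fun x => g' x * psi x).
  by move=> x; apply: (@continuousM _ _ g' psi); [exact: cg'|exact: cpsi].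
have dE x : 'D_e (g * psi) x = g x * 'D_e psi x + g' x * psi x.
  have [dgx <-] := dg x.
  by rewrite (deriveM dgx (dpsi x)) [X in _ + X]mulrC.
apply/eqP; rewrite -addr_eq0 -RintegralD//; last 2 first.
- exact: compact_support_integrable cK s1.
- exact: compact_support_integrable cK s2.
have <- : \int[leb2]_x 'D_e (g * psi) x = 0.
  apply: (integral_partial_compact_support he cK).
  - by move=> x /psi0 px; rewrite -[LHS]/(g x * psi x) px mulr0.
  - by move=> x; apply: derivableM (dpsi x); have [] := dg x.
  - under eq_fun do rewrite dE.
    by move=> x; apply: cvgD; [exact: c1|exact: c2].
by apply/eqP; apply: eq_Rintegral => x _; rewrite dE.
Qed.

(** The candidate to be inserted in the weak formulation. The constant makes the
    mean vanish when there is no Dirichlet condition, and is 0 otherwise. *)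
Definition test_jet (c : R) phi : jet R := (fun x => phi x - c, gradf phi).

Lemma test_jet_H1 c phi : (leb2 (Omega : set (plane R)) < +oo)%E ->
  test_fun Omega phi -> H1 Omega (test_jet c phi).
Proof.
move=> finO tphi; have [sphi _] := tphi.
have parts psi e : e = (1, 0) \/ e = (0, 1) -> test_fun Omega psi ->
  \int[leb2]_(x in Omega) ((phi x - c) * 'D_e psi x)
    = - \int[leb2]_(x in Omega) ('D_e phi x * psi x).
  move=> he tpsi; have [dphi cdphi] := smooth_partial sphi he.
  apply: (integration_by_parts_test he _ _ cdphi tpsi).
    by move=> x; apply: cvgB; [exact: smooth_continuous|exact: cvg_cst].
  move=> x; have dphix : is_derive x e phi ('D_e phi x) by exact/derivableP.
  by rewrite -['D_e phi x]subr0; exact: is_deriveB dphix (is_derive_cst _ _ _).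
split.
- by apply: L2D; [exact: test_fun_L2|exact: L2_cst].
- by apply: test_fun_partial_L2 => //; left.
- by apply: test_fun_partial_L2 => //; right.
- by move=> psi tpsi; split; apply: parts => //; [left|right].
Qed.

Lemma arcint0 (w : seq (R * R)) (A : set (R * R)) f :
  (forall x, A x -> f x = 0) -> arcint w A f = 0%E.
Proof.
move=> f0; rewrite /arcint big1// => i _.
rewrite integral0_eq ?mule0// => t [_ At]; by rewrite f0.
Qed.

Lemma L2norm0 f : (forall x, f x = 0) -> L2norm Omega f = 0%E.
Proof.
move=> f0; rewrite /L2norm.
have -> : EFin \o (f \_ Omega) = cst 0%E.
  by apply/funext => x /=; rewrite restrictE f0 if_same.
by rewrite Lnorm0// eqe pnatr_eq0.
Qed.

(** The support of phi is inside the open set Omega, hence away from GammaD, and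
    the constant sequence phi is an approximating sequence. *)
Lemma test_jet_zero_trace (w : seq (R * R)) (GammaD : set (R * R)) phi :
  GammaD `<=` closure Omega `\` Omega -> test_fun Omega phi ->
  zero_trace Omega w GammaD (test_jet 0 phi).
Proof.
move=> GO [sphi [K [cK KO phi0]]].
exists (fun=> phi); split => //.
- rewrite /= L2norm0; first exact: cvg_cst.
  by move=> x; rewrite /= subr0 subrr.
- rewrite /= L2norm0; first exact: cvg_cst.
  by move=> x; rewrite /= subrr.
- rewrite /= L2norm0; first exact: cvg_cst.
  by move=> x; rewrite /= subrr.
- rewrite /= arcint0; first exact: cvg_cst.
  move=> x /GO[_ Ox]; rewrite phi0 ?expr0n// => /KO; exact: Ox.
Qed.

(** When Omega has measure zero every integral over it vanishes. *)
Lemma test_jet_mean0 phi : (leb2 (Omega : set (plane R)) < +oo)%E ->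
  test_fun Omega phi ->
  exists c, \int[leb2]_(x in Omega) (test_jet c phi).1 x = 0.
Proof.
move=> finO tphi.
have mean c : \int[leb2]_(x in Omega) (phi x - c) =
    \int[leb2]_(x in Omega) phi x - c * fine (leb2 (Omega : set (plane R))).
  rewrite RintegralB//; first by rewrite Rintegral_cst.
  - by apply: L2_integrable => //; exact: test_fun_L2.
  - by apply: L2_integrable => //; exact: L2_cst.
have [muO|muO] := eqVneq (leb2 (Omega : set (plane R))) 0%E.
  exists 0; rewrite /= mean mul0r subr0 /Rintegral.
  rewrite (@null_set_integral _ _ _ leb2 Omega)//.
  by apply/measurable_EFinP; exact: (L2_measurable oO (test_fun_L2 tphi)).
exists (\int[leb2]_(x in Omega) phi x / fine (leb2 (Omega : set (plane R)))).
rewrite /= mean divfK ?subrr// fine_eq0//.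
by rewrite ge0_fin_numE.
Qed.

(** The second conclusion is what lets the constant disappear from the
    right-hand side: either c = 0, or q has zero integral. *)
Lemma test_jet_H1D (w : seq (R * R)) (GammaD : set (R * R))
    (q : R * R -> R) phi :
  (leb2 (Omega : set (plane R)) < +oo)%E ->
  GammaD `<=` closure Omega `\` Omega ->
  (arclen w GammaD = 0%E -> \int[leb2]_(x in Omega) q x = 0) ->
  test_fun Omega phi ->
  exists2 c, H1D Omega w GammaD (test_jet c phi) &
    c * \int[leb2]_(x in Omega) q x = 0.
Proof.
move=> finO GO q0 tphi; have [G0|G0] := eqVneq (arclen w GammaD) 0%E.
  have [c c0] := test_jet_mean0 finO tphi.
  exists c; last by rewrite q0// mulr0.
  by split; [exact: test_jet_H1|rewrite G0 eqxx].
exists 0; last by rewrite mul0r.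
split; first exact: test_jet_H1.
by rewrite (negbTE G0); exact: test_jet_zero_trace.
Qed.

End test_functions.

(** * The energy form *)

Lemma ae_plane (R : realType) (P Q : R * R -> Prop) :
  (forall x, P x -> Q x) ->
  {ae leb2, forall x, P x} -> {ae leb2, forall x, Q x}.
Proof. by move=> PQ; apply: negligibleS => x; exact: contra_not (PQ x). Qed.

Section energy_form.
Context {R : realType}.
Variables (Omega : set (R * R)) (Lambda : R * R -> 'M[R]_2).
Hypothesis oO : open Omega.
Hypothesis coefL : coefficient Omega Lambda.
Let mO : measurable (Omega : set (plane R)) := open_measurable_plane oO.
Let a := aform Omega Lambda.
Let na := anorm Omega Lambda.
Implicit Types u v : jet R.

(** All that the energy form requires of its arguments. Unlike [H1D], it is
    visibly stable under linear combinations. *)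
Definition L2grad (Om : set (R * R)) (v : jet R) :=
  L2 Om (fun x => (v.2 x).1) /\ L2 Om (fun x => (v.2 x).2).

Lemma H1_L2grad v : H1 Omega v -> L2grad Omega v.
Proof. by case. Qed.

Lemma L2grad_comb c u v :
  L2grad Omega u -> L2grad Omega v -> L2grad Omega (c *: u + v).
Proof.
move=> [u1 u2] [v1 v2].
by split; [exact: (L2D (L2Z c u1) v1)|exact: (L2D (L2Z c u2) v2)].
Qed.

Lemma L2grad_sub u v :
  L2grad Omega u -> L2grad Omega v -> L2grad Omega (u - v).
Proof.
move=> [u1 u2] [v1 v2].
by split; [exact: (L2D u1 (L2N v1))|exact: (L2D u2 (L2N v2))].
Qed.

Lemma mulv_L2 u : L2grad Omega u ->
  L2 Omega (fun x => (mulv (Lambda x) (u.2 x)).1) /\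
  L2 Omega (fun x => (mulv (Lambda x) (u.2 x)).2).
Proof.
by have [bL _ _] := coefL; move=> [u1 u2]; split; apply: L2D;
  apply: L2_Linf_mul.
Qed.

Lemma aform_integrable u v : L2grad Omega u -> L2grad Omega v ->
  leb2.-integrable (Omega : set (plane R))
    (EFin \o (fun x => dot (mulv (Lambda x) (u.2 x)) (v.2 x))).
Proof.
move=> /mulv_L2[u1 u2] [v1 v2].
have i1 := L2_mul_integrable oO u1 v1.
have i2 := L2_mul_integrable oO u2 v2.
have := integrableD mO i1 i2.
by apply: eq_integrable => // x _; rewrite /= EFinD.
Qed.

Lemma aform_combr c u v w :
  L2grad Omega u -> L2grad Omega v -> L2grad Omega w ->
  a u (c *: v + w) = c * a u v + a u w.
Proof.
move=> gu gv gw.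
have iv := aform_integrable gu gv; have iw := aform_integrable gu gw.
rewrite /a /aform -RintegralZl// -RintegralD//; last first.
  have := integrableZl mO c iv.
  by apply: eq_integrable => // x _; rewrite /= EFinM.
apply: eq_Rintegral => x _; rewrite /dot.
rewrite -[((c *: v + w).2 x).1]/(c * (v.2 x).1 + (w.2 x).1).
rewrite -[((c *: v + w).2 x).2]/(c * (v.2 x).2 + (w.2 x).2).
by ring.
Qed.

Lemma aform_sym u v : L2grad Omega u -> L2grad Omega v -> a u v = a v u.
Proof.
move=> gu gv; have [_ sL _] := coefL.
have [/measurable_int muv /measurable_int mvu] :=
  (aform_integrable gu gv, aform_integrable gv gu).
congr fine; apply: ae_eq_integral => //.
apply: ae_plane sL => x sx Ox; have [LT _] := sx Ox.
have L01 : Lambda x 0 1 = Lambda x 1 0 by rewrite -[in LHS]LT mxE.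
by rewrite /= /dot /mulv /= L01; congr EFin; ring.
Qed.

Lemma aform_subr u v w :
  L2grad Omega u -> L2grad Omega v -> L2grad Omega w ->
  a u (v - w) = a u v - a u w.
Proof.
by move=> gu gv gw; rewrite addrC -scaleN1r aform_combr// mulN1r addrC.
Qed.

Lemma aform_subl u v w :
  L2grad Omega u -> L2grad Omega v -> L2grad Omega w ->
  a (u - v) w = a u w - a v w.
Proof.
move=> gu gv gw; rewrite (aform_sym (L2grad_sub gu gv) gw) aform_subr//.
by rewrite (aform_sym gw gu) (aform_sym gw gv).
Qed.

Lemma aform_ge0 u : L2grad Omega u -> 0 <= a u u.
Proof.
move=> gu; have [_ sL _] := coefL.
have /measurable_int mu := aform_integrable gu gu.
suff -> : a u u = \int[leb2]_(x in Omega)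
    `|dot (mulv (Lambda x) (u.2 x)) (u.2 x)| by exact: Rintegral_ge0.
congr fine; apply: ae_eq_integral => //.
  have /measurable_EFinP mu' := mu.
  by apply/measurable_EFinP; exact: measurableT_comp.
apply: ae_plane sL => x sx Ox; have [_ Lpos] := sx Ox.
rewrite /= ger0_norm//; have [->|ux] := eqVneq (u.2 x) 0.
  by rewrite /dot /mulv /= !mulr0 !addr0.
by rewrite ltW// Lpos.
Qed.

Lemma anorm_sqr u : L2grad Omega u -> na u ^+ 2 = a u u.
Proof. by move=> gu; rewrite sqr_sqrtr// aform_ge0. Qed.

(** Nonnegativity of the quadratic polynomial t |-> a(t u + v, t u + v). The
    form may be degenerate, and then t is taken so that the polynomial would be
    negative unless a(u, v) = 0. *)
Lemma aform_cauchy_schwarz u v : L2grad Omega u -> L2grad Omega v ->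
  a u v <= na u * na v.
Proof.
move=> gu gv.
have quad t : 0 <= t ^+ 2 * a u u + 2 * t * a u v + a v v.
  have gt := L2grad_comb t gu gv.
  suff <- : a (t *: u + v) (t *: u + v) =
      t ^+ 2 * a u u + 2 * t * a u v + a v v.
    exact: aform_ge0.
  rewrite aform_combr// (aform_sym gt gu) (aform_sym gt gv) !aform_combr//.
  by rewrite (aform_sym gv gu); ring.
rewrite /na /anorm -sqrtrM ?aform_ge0//.
apply: le_trans (ler_norm _) _; rewrite -sqrtr_sqr ler_wsqrtr//.
rewrite -[aform _ _ u u]/(a u u) -[aform _ _ v v]/(a v v).
have au0 := aform_ge0 gu; have av0 := aform_ge0 gv.
have [u0|u0] := eqVneq (a u u) 0.
  have [->|uv0] := eqVneq (a u v) 0; first by rewrite expr0n/= mulr_ge0.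
  (* The polynomial is affine here; its value at this t is -1. *)
  have := quad (- (a v v + 1) / (2 * a u v)).
  rewrite u0 mulr0 add0r (_ : 2 * _ * _ = - (a v v + 1)); last by field.
  by rewrite opprD addrAC addNr add0r oppr_ge0 ler10.
have {u0}ugt0 : 0 < a u u by rewrite lt_neqAle eq_sym u0.
(* The minimum of the polynomial. *)
have := quad (- a u v / a u u).
rewrite (_ : _ + _ = a v v - a u v ^+ 2 / a u u); last by field; rewrite gt_eqF.
by rewrite subr_ge0 ler_pdivrMr// mulrC.
Qed.

End energy_form.

(** * Quasi-optimality for saddle point problems *)

Section saddle_points.
Context {R : realType}.

Lemma lin_span_sub (E : lmodType R) (S : set E) x y :
  lin_span S x -> lin_span S y -> lin_span S (x - y).
Proof.
move=> Sx Sy W W0 WD SW; rewrite -scaleN1r addrC.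
exact: (WD _ _ _ (Sy W W0 WD SW) (Sx W W0 WD SW)).
Qed.

Lemma sub_lin_span (E : lmodType R) (S : set E) : S `<=` lin_span S.
Proof. by move=> x Sx W _ _; exact. Qed.

(** The inf-sup condition read as stability of the multiplier: m is controlled
    by the size of the functional b(., m) on X. *)
Lemma inf_sup_le (E M : lmodType R) (X Z : set E) (b : E -> M -> R)
    (nE : E -> R) (nM : M -> R) (alpha C : R) (m : M) :
  norm_on [set: M] [set 0] nM -> (forall v, X v -> 0 <= nE v) -> 0 <= C ->
  (alpha%:E <= inf_sup X Z b nE nM)%E ->
  (forall v, X v -> b v m <= C * nE v) ->
  alpha * nM m <= C.
Proof.
move=> [nM0 nMZ _ _] nE0 C0 alphab bC.
have [->|mn0] := eqVneq m 0.
  by rewrite (nMZ 0 I).2// mulr0.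
have nMm : 0 < nM m.
  rewrite lt_neqAle nM0// andbT eq_sym; apply/eqP => /(nMZ m I).1 /eqP.
  by rewrite (negbTE mn0).
rewrite -ler_pdivlMr// -lee_fin; apply: le_trans alphab _.
apply: (le_trans (ereal_inf_lbound _)); first by exists m.
apply: ge_ereal_sup => _ [v [Xv _] <-]; rewrite lee_fin.
(* If nE v = 0, the quotient is 0 by the convention on division. *)
have [nv0|nv0] := eqVneq (nE v) 0.
  by rewrite nv0 mul0r invr0 mulr0 divr_ge0// ltW.
have nv : 0 < nE v by rewrite lt_neqAle eq_sym nv0 nE0.
rewrite invfM mulrA; apply: ler_wpM2r; first by rewrite invr_ge0 ltW.
by rewrite ler_pdivrMr ?bC.
Qed.

(** The error estimate for a saddle point problem whose exact multiplier is 0.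
    S is a space on which a is a positive semidefinite bilinear form with
    seminorm na, and b is compared with it only at the differences p - v, where
    the stronger norm nV dominates na. *)
Lemma saddle_point_quasi_optimal (E M : lmodType R) (S P Z : set E)
    (a : E -> E -> R) (b : E -> M -> R) (F : E -> R) (G : M -> R)
    (na nV : E -> R) (nM : M -> R) (beta alpha : R) (p ph : E) (l : M) :
  P `<=` S -> S p ->
  (forall u v, S u -> S v -> S (u - v)) ->
  (forall u v w, S u -> S v -> S w -> a (u - v) w = a u w - a v w) ->
  (forall u v w, S u -> S v -> S w -> a u (v - w) = a u v - a u w) ->
  (forall u v, S u -> S v -> a u v <= na u * na v) ->
  (forall u, S u -> na u ^+ 2 = a u u) ->
  (forall u, 0 <= na u) ->
  (forall v, P v -> b (p - v) l = b p l - b v l) ->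
  (forall v, P v -> `|b (p - v) l| <= beta * nV (p - v) * nM l) ->
  (forall v, P v -> na (p - v) <= nV (p - v)) ->
  0 <= beta -> 0 < alpha -> norm_on [set: M] [set 0] nM ->
  (alpha%:E <= inf_sup P Z b na nM)%E ->
  (forall v, P v -> a p v = F v) -> (forall m, b p m = G m) ->
  saddle_point P a b F G ph l ->
  forall v, P v -> na (p - ph) <= (1 + beta / alpha) * nV (p - v).
Proof.
move=> PS Sp SB aBl aBr cs na2 na0 bB bcont naV beta0 alpha0 nMn infsup ap bp.
move=> [Pph aph bph] v Pv.
have Sph := PS _ Pph; have Sv := PS _ Pv.
have Se := SB _ _ Sp Sph.
have residual y : P y -> a (p - ph) y = b y l.
  by move=> Py; rewrite aBl ?ap -?(aph _ Py)//; [ring|exact: PS].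
have l_le : alpha * nM l <= na (p - ph).
  apply: inf_sup_le infsup _ => // y Py; rewrite -residual//.
  by apply: cs => //; exact: PS.
(* p - ph = (p - v) + v - ph, and the residual turns the last two terms into
   b(v, l) - b(ph, l) = b(v, l) - b(p, l). *)
have energy : na (p - ph) ^+ 2 = a (p - ph) (p - v) - b (p - v) l.
  rewrite na2// !aBr// (residual _ Pph) (residual _ Pv).
  by rewrite bB// bp -(bph l); ring.
have nM0 : 0 <= nM l by case: nMn => + _ _ _; exact.
have nV0 : 0 <= nV (p - v) by exact: le_trans (naV _ Pv).
have b_le : - b (p - v) l <= beta / alpha * nV (p - v) * na (p - ph).
  have := bcont _ Pv; rewrite ler_norml => /andP[+ _].
  rewrite lerNl => /le_trans; apply.
  rewrite -mulrA [leRHS](_ : _ = beta * (nV (p - v) * (na (p - ph) / alpha)));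
    last by field; rewrite gt_eqF.
  do 2 apply: ler_wpM2l => //.
  by rewrite ler_pdivlMr// mulrC.
have a_le : a (p - ph) (p - v) <= na (p - ph) * nV (p - v).
  by apply: le_trans (cs _ _ Se (SB _ _ Sp Sv)) _; exact/ler_wpM2l/naV.
have [->|e0] := eqVneq (na (p - ph)) 0.
  by rewrite mulr_ge0// addr_ge0// divr_ge0// ltW.
have e_gt0 : 0 < na (p - ph) by rewrite lt_neqAle eq_sym e0 na0.
rewrite -(ler_pM2r e_gt0) -expr2 energy.
apply: le_trans (lerD a_le b_le) _.
by rewrite le_eqVlt; apply/orP; left; apply/eqP; ring.
Qed.

End saddle_points.

Lemma form_subl_on (R : realType) (E M : lmodType R) (W : set E)
    (b : E -> M -> R) :
  (forall (c : R) u v m, W u -> W v -> b (c *: u + v) m = c * b u m + b v m) ->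
  forall u v m, W u -> W v -> b (u - v) m = b u m - b v m.
Proof.
move=> bl u v m Wu Wv; rewrite addrC -scaleN1r bl//.
by rewrite mulN1r addrC.
Qed.

(** * The flux of the exact solution and the error estimate *)

Section continuous_problem.
Context {R : realType}.
Variables (Omega : set (R * R)) (w : seq (R * R)) (GammaD : set (R * R)).
Variables (Lambda : R * R -> 'M[R]_2) (q : R * R -> R) (p : jet R).
Hypothesis oO : open Omega.
Hypothesis finO : (leb2 (Omega : set (plane R)) < +oo)%E.
Hypothesis GO : GammaD `<=` closure Omega `\` Omega.
Hypothesis coefL : coefficient Omega Lambda.
Hypothesis q2 : L2 Omega q.
Hypothesis q0 : arclen w GammaD = 0%E -> \int[leb2]_(x in Omega) q x = 0.
Hypothesis HDp : H1D Omega w GammaD p.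
Hypothesis solp : forall v, H1D Omega w GammaD v ->
  aform Omega Lambda p v = Fform Omega q v.
Let mO : measurable (Omega : set (plane R)) := open_measurable_plane oO.

Lemma Fform_test_jet c phi : test_fun Omega phi ->
  Fform Omega q (test_jet c phi) =
    \int[leb2]_(x in Omega) (q x * phi x) - c * \int[leb2]_(x in Omega) q x.
Proof.
move=> tphi; rewrite -RintegralZl//; last exact: L2_integrable.
rewrite -RintegralB//.
- by apply: eq_Rintegral => x _; rewrite /=; ring.
- exact: (L2_mul_integrable oO q2 (test_fun_L2 tphi)).
- exact: (L2_mul_integrable oO (L2_cst oO finO c) q2).
Qed.

(** The weak formulation tested with [test_jet c phi], whose gradient is that of
    phi. *)
Lemma solution_weak_div :
  weak_div Omega (fun x => mulv (Lambda x) (p.2 x)) (fun x => - q x).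
Proof.
split; first exact: L2N.
move=> phi tphi.
have [c Hc cq0] := test_jet_H1D oO finO GO q0 tphi.
have := solp Hc; rewrite Fform_test_jet// cq0 subr0 /aform /= => ->.
have := RintegralZl (-1) mO (L2_mul_integrable oO q2 (test_fun_L2 tphi)).
rewrite mulN1r => /(congr1 -%R); rewrite opprK => <-.
by congr (- _); apply: eq_Rintegral => x _; rewrite mulN1r mulNr.
Qed.

Lemma solution_H1divL : H1divL Omega w GammaD Lambda p.
Proof.
have [Hp _] := HDp.
split => //; have [L1 L2'] := mulv_L2 coefL (H1_L2grad Hp).
by split => //; exists (fun x => - q x); exact: solution_weak_div.
Qed.

End continuous_problem.

Theorem theorem3 (R : realType)
    (Omega : set (R * R)) (w : seq (R * R)) (GammaD : set (R * R))
    (Lambda : R * R -> 'M[R]_2) (q : R * R -> R)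
    (r Nh : nat) (T : 'I_Nh -> cell R)
    (V : R * R -> set (R * R)) (bV : R * R -> seq (R * R))
    (Ns : nat) (z : 'I_Ns -> R * R)
    (abar : jet R -> 'rV[R]_Ns -> R)
    (normV : jet R -> R) (normM : 'rV[R]_Ns -> R)
    (abar_bound alpha : R) (p : jet R) :
  let a := aform Omega Lambda in
  let na := anorm Omega Lambda in
  let F := Fform Omega q in
  let Fb := Fbar Omega q V z in
  let HD := H1D Omega w GammaD in
  let Hdiv := H1divL Omega w GammaD Lambda in
  let P := PhD Omega w GammaD r T in
  let VH := Vh Omega w GammaD Lambda r T in
  convex_polygonal_domain w Omega ->
  measurable GammaD ->
  GammaD `<=` closure Omega `\` Omega ->
  coefficient Omega Lambda ->
  L2 Omega q ->
  (arclen w GammaD = 0%E -> \int[leb2]_(x in Omega) q x = 0) ->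
  triangulation Omega T ->
  dual_partition Omega T V bV ->
  dual_enumeration w GammaD T V z ->
  total_flux_form Omega w GammaD Lambda r T V bV z abar ->
  norm_on VH (ae_zero Omega) normV ->
  norm_on [set: 'rV[R]_Ns] [set 0] normM ->
  (forall v, VH v -> na v <= normV v) ->
  0 <= abar_bound ->
  (forall v m, VH v -> `|abar v m| <= abar_bound * normV v * normM m) ->
  0 < alpha ->
  (alpha%:E <= inf_sup P (ae_zero Omega) abar na normM)%E ->
  HD p ->
  (forall v, HD v -> a p v = F v) ->
  [/\ Hdiv p,
      forall m, abar p m = Fb m,
      saddle_point Hdiv a abar F Fb p 0 &
      forall (ph : jet R) (lh : 'rV[R]_Ns),
        saddle_point P a abar F Fb ph lh ->
        na (p - ph) <=
          2 * (1 + abar_bound / alpha) * inf [set normV (p - v) | v in P]].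
Proof.
move=> a na F Fb HD Hdiv P VH [oO _ polyO] _ GO coefL q2 q0 _ [Vpoly _ _].
move=> [_ zV] [abarl abarr abar_div _] _ nMn naV beta0 abarB alpha0 infsup HDp.
move=> solp.
have finO : (leb2 (Omega : set (plane R)) < +oo)%E.
  have [_ _ cO _ _] := polyO.
  apply: leb2_fin_sub_compact cO _; first exact: open_measurable_plane.
  exact: subset_closure.
have Hdivp : Hdiv p.
  exact: (solution_H1divL oO finO GO coefL q2 q0 HDp solp).
have HdivVH : Hdiv `<=` VH.
  by move=> v Hv; apply: sub_lin_span; right.
have PVH : P `<=` VH by move=> v Pv; apply: sub_lin_span; left.
have abarp m : abar p m = Fb m.
  (* The divergence of Lambda grad p is - q, and the flux form is minus its
     integral. *)
  have wd := solution_weak_div oO finO GO q2 q0 solp.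
  rewrite (abar_div _ _ _ Hdivp wd); apply: eq_bigr => k _; congr (_ * _).
  have [[_ _ cV _ _] _ _] : [/\ polygon (bV (z k)) (V (z k)), V (z k) (z k) &
      V (z k) `<=` closure Omega].
    have : range z (z k) by exists k.
    by rewrite zV => -[/Vpoly].
  have mVO : measurable (V (z k) `&` Omega : set (plane R)).
    apply: measurableI; first exact: compact_measurable_plane.
    exact: open_measurable_plane.
  have iq : leb2.-integrable (V (z k) `&` Omega : set (plane R)) (EFin \o q).
    apply: (integrableS _ _ _ (L2_integrable oO finO q2)) => //.
    exact: open_measurable_plane.
  by under eq_Rintegral do rewrite -mulN1r; rewrite RintegralZl// mulN1r opprK.
split => //.
  split => // v Hv.
  have -> : abar v 0 = 0.
    have := abarr 1 v 0 0 (HdivVH _ Hv).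
    rewrite scaler0 addr0 mul1r => /eqP.
    by rewrite -subr_eq subrr eq_sym => /eqP.
  by rewrite addr0; apply: solp; case: Hv.
move=> ph lh sad.
have [Pph _ _] := sad.
have VHp : VH p by exact: HdivVH.
have VHsub v : P v -> VH (p - v).
  by move=> Pv; apply: lin_span_sub => //; exact: PVH.
have gradH v : HD v -> L2grad Omega v by case=> /H1_L2grad.
have PS : P `<=` L2grad Omega by move=> v [_ /gradH].
have := @saddle_point_quasi_optimal R _ _ (L2grad Omega) P (ae_zero Omega)
  a abar F Fb na normV normM abar_bound alpha p ph lh PS (gradH _ HDp)
  (@L2grad_sub _ _).
move=> /(_ (aform_subl oO coefL) (aform_subr oO coefL)
  (aform_cauchy_schwarz oO coefL) (anorm_sqr oO coefL)).
move=> /(_ (fun u => sqrtr_ge0 _)).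
move=> /(_ (fun v Pv => form_subl_on abarl lh VHp (PVH _ Pv))).
move=> /(_ (fun v Pv => abarB _ lh (VHsub _ Pv))).
move=> /(_ (fun v Pv => naV _ (VHsub _ Pv)) beta0 alpha0 nMn infsup).
move=> /(_ (fun v Pv => solp _ (proj2 Pv)) abarp sad) quasi_opt.
have C0 : 0 < 1 + abar_bound / alpha.
  by rewrite ltr_wpDr// divr_ge0// ltW.
(* The constant is moved to the left, to use that an infimum is at least every
   lower bound of a nonempty set. *)
rewrite mulrC -ler_pdivrMr ?mulr_gt0//.
apply: lb_le_inf; first by exists (normV (p - ph)), ph.
move=> _ [v Pv <-]; rewrite ler_pdivrMr ?mulr_gt0//.
have nV0 : 0 <= normV (p - v).
  exact: le_trans (sqrtr_ge0 _) (naV _ (VHsub _ Pv)).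
apply: le_trans (quasi_opt v Pv) _; rewrite [leRHS]mulrC ler_wpM2r//.
by rewrite ler_peMl ?ler1n// ltW.
Qed.
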